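(* For every integer $n\geqslant 0$, $$\sum_{k=0}^{\lfloor n/2\rfloor}\ \sum_{q=0}^{n-2k}\binom{n-k}{q}=2^{n+1}-F_{n+2}.$$
   Context: $(F_n)_{n\geqslant 0}$ denotes the Fibonacci numbers: $F_0=0$, $F_1=1$, and $F_{n+2}=F_{n+1}+F_n$ for all $n\geqslant 0$. *)

(* Defs.v *)
From mathcomp Require Import all_boot all_order all_algebra.

Set Implicit Arguments.
Unset Strict Implicit.
Unset Printing Implicit Defensive.

(* F_0 = 0 and F_1 = 1. The [fibonacci] of Stdlib's Zgcd_alt is indexed one
   step later (it starts at 1, 1), hence this definition. *)
Fixpoint fib (n : nat) : nat :=
  match n with
  | 0 => 0
  | 1 => 1
  | (m.+1 as p).+1 => fib p + fib m
  end.

(* Main.v *)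
Require Import Defs.
From mathcomp Require Import all_boot all_order all_algebra.
From mathcomp Require Import zify.

(** Summing Pascal's rule gives one for partial sums of binomial rows.  Write
    [P m r] for the sum of the first [r] entries of row [m]; then
    [P m.+1 r.+1 = P m r.+1 + P m r].  The double sum is
    [S n = \sum_k P (n - k) (n.+1 - 2 * k)], and when the rule is applied to
    each term of [S n.+2], the terms [P m r] rebuild [S n.+1], while the terms
    [P m r.+1], after the shift [k -> k.+1], rebuild [S n], except for the term
    [k = 0], which is the full row sum [2 ^ n.+1].  Hence
    [S n.+2 = S n.+1 + S n + 2 ^ n.+1] ([diag_partial_row_sumSS]).  The
    sequence [2 ^ n.+1 - fib n.+2] satisfies the same recurrence, because
    [2 ^ n.+2 + 2 ^ n.+1 + 2 ^ n.+1 = 2 ^ n.+3], and it has the same two initial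
    values. *)

Definition partial_row_sum (m r : nat) : nat := \sum_(0 <= q < r) 'C(m, q).

(** The predecessor makes the rule hold at [r = 0] too, where all three sums
    are empty. *)
Lemma partial_row_sumS m r :
  partial_row_sum m.+1 r = partial_row_sum m r + partial_row_sum m r.-1.
Proof.
case: r => [|r]; first by rewrite /partial_row_sum !big_geq.
rewrite /partial_row_sum /= big_nat_recl // [in RHS]big_nat_recl // !bin0.
by rewrite -addnA -big_split.
Qed.

Lemma partial_row_sum_full m r : m < r -> partial_row_sum m r = 2 ^ m.
Proof.
elim: m r => [|m IHm] [|r] // lt_mr.
  by rewrite /partial_row_sum big_nat_recl // bin0 big1.
by rewrite partial_row_sumS !IHm // ?expnS; lia.
Qed.

(** The index [k] runs up to [n] rather than [n %/ 2]: for [n < 2 * k] the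
    truncated subtraction makes the term an empty sum, and a range free of
    halves behaves uniformly when [n] changes. *)
Definition diag_partial_row_sum (n : nat) : nat :=
  \sum_(0 <= k < n.+1) partial_row_sum (n - k) (n.+1 - 2 * k).

Lemma diag_partial_row_sumE n :
  \sum_(0 <= k < (n %/ 2).+1) \sum_(0 <= q < (n - 2 * k).+1) 'C(n - k, q)
  = diag_partial_row_sum n.
Proof.
rewrite /diag_partial_row_sum.
rewrite [RHS](big_cat_nat (n := (n %/ 2).+1)) ?ltnS ?leq_div //=.
rewrite [X in _ = _ + X]big_nat_cond [X in _ = _ + X]big1 ?addn0; last first.
  by move=> k le_k; rewrite /partial_row_sum big_geq //; lia.
apply: eq_big_nat => k le_k; rewrite /partial_row_sum.
by congr (\sum_(0 <= q < _) _); lia.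
Qed.

Lemma diag_partial_row_sumSS n :
  diag_partial_row_sum n.+2
  = diag_partial_row_sum n.+1 + diag_partial_row_sum n + 2 ^ n.+1.
Proof.
rewrite {1}/diag_partial_row_sum big_nat_recr //=.
(* The last term, [k = n.+2], is an empty sum; without it, every remaining row
   index [n.+2 - k] is a successor. *)
rewrite [X in _ + X]/partial_row_sum [X in _ + X]big_geq ?addn0; last lia.
under eq_big_nat => k lt_k.
  rewrite (_ : n.+2 - k = (n.+1 - k).+1); last lia.
  rewrite partial_row_sumS (_ : (n.+3 - 2 * k).-1 = n.+2 - 2 * k); last lia.
  over.
rewrite big_split /= addnC -addnA; congr (_ + _).
rewrite big_nat_recl //= partial_row_sum_full; last lia.
rewrite addnC subn0; congr (_ + _).
by apply: eq_big_nat => k _; congr partial_row_sum; lia.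
Qed.

Lemma diag_partial_row_sum_fib n :
  diag_partial_row_sum n + fib n.+2 = 2 ^ n.+1.
Proof.
have fibSS m : fib m.+2 = fib m.+1 + fib m by [].
(* The recurrence has order two, so two consecutive values are carried. *)
suff [] : diag_partial_row_sum n + fib n.+2 = 2 ^ n.+1 /\
          diag_partial_row_sum n.+1 + fib n.+3 = 2 ^ n.+2 by [].
elim: n => [|n [IHn IHn1]]; first by rewrite -!diag_partial_row_sumE !unlock.
split=> //; rewrite diag_partial_row_sumSS (fibSS n.+2).
by move: IHn IHn1; rewrite !expnS; lia.
Qed.

Local Open Scope ring_scope.

Theorem theorem1 (n : nat) :
  (\sum_(0 <= k < (n %/ 2).+1)
     \sum_(0 <= q < (n - 2 * k).+1) 'C(n - k, q))%N%:Z
  = 2%:Z ^+ n.+1 - (fib n.+2)%:Z.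
Proof.
rewrite diag_partial_row_sumE; apply/eqP; rewrite eq_sym GRing.subr_eq eq_sym.
by rewrite -PoszD diag_partial_row_sum_fib -!natz GRing.natrX.
Qed.
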